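(* For every $n\ge1$, let $\det_n$ and $\operatorname{perm}_n$ denote the determinant and the permanent of an $n\times n$ matrix of $n^2$ independent variables over $\mathbb C$, regarded as homogeneous polynomials of degree $n$ in $n^2$ variables. Then $$R(\det\nolimits_n)\ge\binom{n}{\lfloor n/2\rfloor}^2+n^2-(\lfloor n/2\rfloor+1)^2,$$ $$R(\operatorname{perm}_n)\ge\binom{n}{\lfloor n/2\rfloor}^2+n(n-\lfloor n/2\rfloor-1).$$
   Context: The rank $R(\phi)$ of a complex homogeneous polynomial $\phi$ of degree $d$ is the smallest $r$ such that $\phi$ is a sum of $r$ $d$-th powers of complex linear forms in the given variables. *)

(* Defs.v *)
From mathcomp Require Import all_boot all_fingroup all_algebra.
From mathcomp Require Import boolp reals complex mpoly.

Set Implicit Arguments.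
Unset Strict Implicit.
Unset Printing Implicit Defensive.

Import GRing.Theory.
Local Open Scope ring_scope.

Definition sum_of_powers (K : comNzRingType) (m d : nat) (phi : {mpoly K[m]})
    (r : nat) : Prop :=
  exists l : 'I_r -> {mpoly K[m]},
    (forall i, l i \is 1.-homog) /\ phi = \sum_(i < r) l i ^+ d.

(* The value 0 is a default when phi is not a sum of d-th powers at all.  A
   positive lower bound on the rank therefore also asserts that phi is one. *)
Definition waring_rank (K : comNzRingType) (m d : nat) (phi : {mpoly K[m]}) :
    nat :=
  if pselect (exists r, `[< sum_of_powers d phi r >]) is left h
  then ex_minn h else 0%N.

Lemma waring_rankP (K : comNzRingType) (m d : nat) (phi : {mpoly K[m]}) :
  (exists r, sum_of_powers d phi r) ->
  sum_of_powers d phi (waring_rank d phi) /\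
  forall r, sum_of_powers d phi r -> (waring_rank d phi <= r)%N.
Proof.
move=> [r0 hr0]; rewrite /waring_rank; case: pselect => [h|[]]; last first.
  by exists r0; apply/asboolP.
by case: ex_minnP => r /asboolP hr rmin; split=> // s hs; apply/rmin/asboolP.
Qed.

Definition permanent (K : comNzRingType) (n : nat) (A : 'M[K]_n) : K :=
  \sum_(s : 'S_n) \prod_(i < n) A i (s i).

(* mxvec_index is a bijection from pairs (i, j) onto 'I_(n * n), so the
   entries are n * n distinct variables. *)
Definition generic_matrix (K : comNzRingType) (n : nat) :
    'M[{mpoly K[n * n]}]_n :=
  \matrix_(i, j) 'X_(mxvec_index i j).

Definition det_poly (K : comNzRingType) (n : nat) : {mpoly K[n * n]} :=
  \det (generic_matrix K n).

Definition perm_poly (K : comNzRingType) (n : nat) : {mpoly K[n * n]} :=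
  permanent (generic_matrix K n).

Lemma prod_generic_dhomog (K : comNzRingType) (n : nat) (s : 'S_n) :
  \prod_(i < n) generic_matrix K n i (s i) \is n.-homog.
Proof.
have -> : \prod_(i < n) generic_matrix K n i (s i)
          = \prod_(p <- [tuple generic_matrix K n i (s i) | i < n]) p.
  by rewrite big_tuple; apply: eq_bigr => i _; rewrite tnth_mktuple.
have sz : (\sum_(k <- [tuple 1 | _ < n]) k = n)%N.
  rewrite big_tuple (eq_bigr (fun=> 1%N)) ?sum1_card ?card_ord // => i _.
  by rewrite tnth_mktuple.
rewrite -[X in _ \is X.-homog]sz.
apply: dhomog_prod => i; rewrite !tnth_mktuple mxE dhomogX.
by apply/eqP; exact: mdeg1.
Qed.

Lemma det_poly_dhomog (K : comNzRingType) (n : nat) :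
  det_poly K n \is n.-homog.
Proof.
apply: rpred_sum => s _; rewrite -signr_odd mulr_sign.
by case: ifP => _; rewrite ?rpredN; exact: prod_generic_dhomog.
Qed.

Lemma perm_poly_dhomog (K : comNzRingType) (n : nat) :
  perm_poly K n \is n.-homog.
Proof. by apply: rpred_sum => s _; exact: prod_generic_dhomog. Qed.

(* Main.v *)
(** Write [phi = \sum_(i < r) c_i ^ n] for the determinant or the permanent, and
    put [b = n./2], [a = n - b].  The coefficient of [X ^ b] in
    [phi (x + X y) = \sum_i (<x, c_i> + X <y, c_i>) ^ n] is, up to a binomial
    factor, the pairing of [(<x, c_i> ^ a)_i] with [(<y, c_i> ^ b)_i].  Partial
    permutation matrices [x] of size [a] and [y] of size [b] make this pairing
    of rank at least ['C(n, b) ^ 2].  If [z] is a point of multiplicity greater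
    than [b] of the hypersurface [phi = 0], then [(<z, c_i> ^ a)_i] lies in the
    kernel, of dimension at most [r - 'C(n, b) ^ 2], and is cut out there by as
    many linear conditions [<z, c_i> = 0] on [z].  If these had a common nonzero
    solution among such points, all [<z, c_i>] would vanish and [phi] would not
    depend on the direction [z].  Hence [r - 'C(n, b) ^ 2] is at least the
    dimension of the cone of such points, which contains the matrices with
    [b + 1] zero rows and, for the determinant, those of rank [< a].

    For the latter one needs that [k] linear forms on a cone carrying more than
    [k] algebraically independent coordinates have a common nonzero zero in its
    closure.  Adjoin the coordinates to the linear forms one at a time: either
    each is integral over the previous ones, which contradicts the growth of
    the number of monomials, or one of them is not, which gives a nonzero point
    at which the forms vanish, and it lifts along the integral extensions. *)

From HB Require Import structures.
Require Import Defs.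
From mathcomp Require Import all_boot all_fingroup all_algebra.
From mathcomp Require Import boolp reals complex mpoly.
From mathcomp Require Import ring.

Set Implicit Arguments.
Unset Strict Implicit.
Unset Printing Implicit Defensive.

Import GRing.Theory Num.Theory.
Local Open Scope ring_scope.

(** * Lying over *)

(** By the factor theorem [f] is divisible by X - a, and the determinant of [C - a%:M] is, up to
    sign, the characteristic polynomial at [a]. *)
Lemma det_horner_mx_root (K : comNzRingType) (n : nat) (C : 'M[K]_n.+1)
    (f : {poly K}) (a : K) :
  f.[a] = 0 -> (char_poly C).[a] = 0 -> \det (horner_mx C f) = 0.
Proof.
move=> /eqP/factor_theorem[q ->] Ca0.
rewrite rmorphM det_mulmx rmorphB /= horner_mx_X horner_mx_C.
suff -> : \det (C - a%:M) = 0 by rewrite mulr0.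
have -> : C - a%:M = - map_mx (horner_eval a) (char_poly_mx C).
  by apply/matrixP=> i j; rewrite !mxE /horner_eval !hornerE hornerMn hornerX
    opprB.
by rewrite -scaleN1r detZ det_map_mx /horner_eval [X in _ * X]Ca0 mulr0.
Qed.

(* The norm of [f] in [P[X]/(g)] lies in the ideal [(f, g)], so it vanishes on
   [T]; were [f] to specialize to a nonzero constant, so would its norm. *)
Lemma specialization_nonunit (K P : comNzRingType) (T : Type)
    (rho : T -> {rmorphism P -> K}) (chi : {rmorphism P -> K}) (a : T -> K)
    (f g : {poly P}) (c : K) :
    g \is monic ->
    (forall x, (map_poly (rho x) g).[a x] = 0) ->
    (forall p, (forall x, rho x p = 0) -> chi p = 0) ->
    (forall x, (map_poly (rho x) f).[a x] = 0) ->
    map_poly chi f = c%:P ->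
  exists m, c ^+ m = 0.
Proof.
move=> gm ga rc fa fc.
have chi1 : (forall x, rho x 1 = 0) -> False.
  by move=> /rc /eqP; rewrite rmorph1 oner_eq0.
have [m [C Cg]] : exists m, exists C : 'M[P]_m, char_poly C = g.
  by exists _, (companionmx g); exact: companionmxK.
(* For [m = 0] the polynomial [g] is 1 and has no root, so [T] is empty and [rc] would force
   [chi 1 = 0]. *)
case: m C Cg => [|m] C Cg.
  case: chi1 => x; have := ga x; rewrite -Cg /char_poly det_mx00.
  by rewrite [map_poly _ _]rmorph1 hornerE rmorph1.
exists m.+1; rewrite -det_scalar -(horner_mx_C (map_mx chi C)) -fc.
rewrite -map_horner_mx det_map_mx; apply: rc => x.
rewrite -det_map_mx map_horner_mx; apply: (det_horner_mx_root (fa x)).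
by rewrite -map_char_poly Cg.
Qed.

(** The polynomials vanishing at all [a x] specialize under [chi] to an ideal of polynomials over
    the field [K]. A nonzero member of least degree generates it, cannot be constant by
    [specialization_nonunit], and so has a root. *)
Lemma lying_over (K : closedFieldType) (P : comNzRingType) (T : Type)
    (rho : T -> {rmorphism P -> K}) (chi : {rmorphism P -> K}) (iota : K -> P)
    (a : T -> K) (g : {poly P}) :
    cancel iota chi -> g \is monic ->
    (forall x, (map_poly (rho x) g).[a x] = 0) ->
    (forall p, (forall x, rho x p = 0) -> chi p = 0) ->
  exists c, forall f : {poly P},
    (forall x, (map_poly (rho x) f).[a x] = 0) -> (map_poly chi f).[c] = 0.
Proof.
move=> iotaK gm ga rc.
pose J f := forall x, (map_poly (rho x) f).[a x] = 0.
pose I n := `[< exists f, [/\ J f, map_poly chi f != 0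
                            & size (map_poly chi f) = n] >].
have exI : exists n, I n.
  exists (size (map_poly chi g)); apply/asboolP; exists g; split=> //.
  by rewrite monic_neq0 // monic_map.
case: (ex_minnP exI) => n /asboolP[h [Jh h0 <-]] hmin.
have dvd f : J f -> map_poly chi h %| map_poly chi f.
  (* Lifting the quotient through [iota] shows that the remainder is again the specialization of a
     polynomial in [J]. *)
  move=> Jf; set q := map_poly chi f %/ map_poly chi h.
  have Qq : map_poly chi (\poly_(i < size q) iota q`_i) = q.
    apply/polyP => i; rewrite coef_map coef_poly; case: ltnP => [_|qi] /=.
      exact: iotaK.
    by rewrite rmorph0 nth_default.
  move: (\poly_(i < size q) iota q`_i) Qq => Q' Qq.
  have e : map_poly chi (f - Q' * h) = map_poly chi f %% map_poly chi h.
    rewrite rmorphB rmorphM /= Qq {1}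
      (divp_eq (map_poly chi f) (map_poly chi h)).
    by rewrite addrAC subrr add0r.
  apply/negPn/negP => nz; have := hmin (size (map_poly chi (f - Q' * h))).
  rewrite e leqNgt ltn_modp h0 => /(_ _)/negP; apply=> //.
  apply/asboolP; exists (f - Q' * h); split; rewrite ?e //.
  by move=> x; rewrite rmorphB rmorphM /= !hornerE Jf Jh mulr0 subrr.
have [s1|] := eqVneq (size (map_poly chi h)) 1%N.
  have [c c0 hc] := size_poly1P _ (introT eqP s1).
  have [m /eqP] := specialization_nonunit gm ga rc Jh hc.
  by rewrite expf_eq0 (negPf c0) andbF.
case/closed_rootP => c hc; exists c => f /dvd/dvdpP[q ->].
by rewrite hornerM (rootP hc) mulr0.
Qed.

(** * Projective elimination *)

Section FunctionSpan.
Variables (K : comNzRingType) (T : Type).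
Implicit Types (E F : (T -> K) -> Prop) (phi psi : T -> K).

(** Functions on [T] stand for elements of the coordinate ring of the closure, so no quotient by an
    ideal has to be formed. *)
Inductive fspan E : (T -> K) -> Prop :=
| fspan0 : fspan E (fun=> 0)
| fspanS c phi psi :
    E phi -> fspan E psi -> fspan E (fun x => c * phi x + psi x).

Lemma eq_fspan E phi psi : phi =1 psi -> fspan E phi -> fspan E psi.
Proof. by move=> /funext ->. Qed.

Lemma fspan_add E phi psi :
  fspan E phi -> fspan E psi -> fspan E (fun x => phi x + psi x).
Proof.
elim=> [|c u v Eu _ IH] Epsi; first by apply: eq_fspan Epsi => x; rewrite add0r.
by apply: eq_fspan (fspanS c Eu (IH Epsi)) => x; rewrite addrA.
Qed.

Lemma fspan_scale E c phi : fspan E phi -> fspan E (fun x => c * phi x).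
Proof.
elim=> [|d u v Eu _ IH]; first by apply: eq_fspan (fspan0 E) => x;
  rewrite mulr0.
by apply: eq_fspan (fspanS (c * d) Eu IH) => x; rewrite mulrDr mulrA.
Qed.

Lemma fspan_gen E phi : E phi -> fspan E phi.
Proof.
by move=> Ep; apply: eq_fspan (fspanS 1 Ep (fspan0 E)) => x;
  rewrite mul1r addr0.
Qed.

Lemma fspan_sum E (I : Type) (r : seq I) (P : pred I) (F : I -> T -> K) :
  (forall i, P i -> fspan E (F i)) ->
  fspan E (fun x => \sum_(i <- r | P i) F i x).
Proof.
move=> EF; elim: r => [|i r IH].
  by apply: eq_fspan (fspan0 E) => x; rewrite big_nil.
case Pi: (P i); last by apply: eq_fspan IH => x; rewrite big_cons Pi.
by apply: eq_fspan (fspan_add (EF i Pi) IH) => x; rewrite big_cons Pi.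
Qed.

Lemma fspan_mul E F u phi :
  (forall psi, E psi -> fspan F (fun x => u x * psi x)) ->
  fspan E phi -> fspan F (fun x => u x * phi x).
Proof.
move=> EF; elim=> [|c v w Ev _ IH].
  by apply: eq_fspan (fspan0 F) => x; rewrite mulr0.
apply: eq_fspan (fspan_add (fspan_scale c (EF _ Ev)) IH) => x.
by rewrite mulrDr mulrCA.
Qed.

Lemma fspan_trans E F phi :
  (forall psi, E psi -> fspan F psi) -> fspan E phi -> fspan F phi.
Proof.
move=> EF Ep; have := @fspan_mul E F (fun=> 1) phi.
move=> /(_ _ Ep) H; apply: eq_fspan (H _) => [x|psi /EF];
  first by rewrite mul1r.
by apply: eq_fspan => x; rewrite mul1r.
Qed.

End FunctionSpan.

(** * Finiteness and integrality in graded rings of functions *)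

Section Monomials.
Variables (K : comNzRingType) (T : Type) (M : nat) (b : T -> 'I_M -> K).
Implicit Types (s B : {set 'I_M}) (phi psi : T -> K).

Fixpoint monomial s m phi : Prop :=
  if m is m'.+1 then exists i psi,
    [/\ i \in s, monomial s m' psi & forall x, phi x = b x i * psi x]
  else forall x, phi x = 1.

Lemma monomialS s s' m phi :
  s \subset s' -> monomial s m phi -> monomial s' m phi.
Proof.
move=> /subsetP ss; elim: m phi => //= m IH phi [i [psi [/ss si /IH mpsi e]]].
by exists i, psi.
Qed.

Lemma monomialM s m n phi psi :
  monomial s m phi -> monomial s n psi ->
  monomial s (m + n) (fun x => phi x * psi x).
Proof.
move=> + npsi; elim: m phi => [|m IH] phi /=.
  by move=> /funext ->; rewrite (_ : (fun x => _) = psi) //; apply/funext => x;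
    rewrite mul1r.
move=> [i [chi [si /IH mchi e]]]; exists i, (fun x => chi x * psi x);
  split=> //.
by move=> x; rewrite e mulrA.
Qed.

Lemma monomialX s i a : i \in s -> monomial s a (fun x => b x i ^+ a).
Proof.
move=> si; elim: a => [|a IH] //=.
by exists i, (fun x => b x i ^+ a); split=> // x; rewrite exprS.
Qed.

Definition reducible B s m phi : Prop := exists i psi,
  [/\ i \in B, monomial s m psi & phi = fun x => b x i * psi x].

(* In all large degrees the graded ring generated by the coordinates in [s]
   lies in the ideal generated by those in [B], i.e. it is a finite module over
   the ring these generate. *)
Definition finite_over B s : Prop :=
  exists m0, forall m phi, (m0 <= m)%N -> monomial s m.+1 phi ->
    fspan (reducible B s m) phi.

(** Normal form in degree [m] modulo a monic equation of degree [e] for coordinate [j]: only powers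
    below [e] occur. *)
Definition lower_monomial j s e m phi : Prop := exists a d psi,
  [/\ (a < e)%N, (a + d = m)%N, monomial s d psi
    & phi = fun x => b x j ^+ a * psi x].

Definition homog_integral j s e : Prop :=
  fspan (lower_monomial j s e e) (fun x => b x j ^+ e).

Lemma finite_over_refl B : finite_over B B.
Proof.
exists 0%N => m phi _ /= [i [psi [iB mpsi /funext ->]]].
by apply: fspan_gen; exists i, psi.
Qed.

Lemma fspan_lower_monomialM j s e m d phi psi :
    fspan (lower_monomial j s e m) phi -> monomial s d psi ->
  fspan (lower_monomial j s e (m + d)) (fun x => phi x * psi x).
Proof.
move=> sphi mpsi; apply: (@eq_fspan _ _ _ (fun x => psi x * phi x)).
  by move=> x; rewrite mulrC.
apply: fspan_mul sphi => _ [a [d' [chi [ae <- mchi ->]]]]; apply: fspan_gen.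
exists a, (d' + d)%N, (fun x => chi x * psi x); split; rewrite ?addnA //.
  exact: monomialM.
by apply/funext => x; rewrite mulrC mulrA.
Qed.

Lemma homog_integral_exp j s e a :
  homog_integral j s e -> fspan (lower_monomial j s e a) (fun x => b x j ^+ a).
Proof.
move=> rel; elim: a => [|a IH].
  have [e0|e_gt0] := posnP e; first by move: rel; rewrite /homog_integral e0.
  apply: fspan_gen; exists 0%N, 0%N, (fun=> 1); split=> //.
  by apply/funext => x; rewrite mulr1.
apply: (@eq_fspan _ _ _ (fun x => b x j * b x j ^+ a)) => [x|].
  by rewrite exprS.
apply: fspan_mul IH => _ [a' [d [psi [ae <- mpsi ->]]]].
have [ae'|] := ltnP a'.+1 e.
  apply: fspan_gen; exists a'.+1, d, psi; split=> //.
  by apply/funext => x; rewrite exprS mulrA.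
move=> ea; have {ea ae} ee : e = a'.+1 by apply/eqP; rewrite eqn_leq ea ae.
apply: (@eq_fspan _ _ _ (fun x => b x j ^+ e * psi x)) => [x|].
  by rewrite ee exprS mulrA.
by rewrite -addSn -ee; exact: fspan_lower_monomialM.
Qed.

Lemma monomialU1 j s m phi : monomial (j |: s) m phi -> exists a d psi,
  [/\ (a + d)%N = m, monomial s d psi & forall x, phi x = b x j ^+ a * psi x].
Proof.
elim: m phi => [|m IH] phi /=.
  move=> p1; exists 0%N, 0%N, (fun=> 1); split=> // x.
  by rewrite p1 mulr1.
move=> [i [psi [+ /IH[a [d [chi [<- mchi e1]]]] e2]]].
rewrite in_setU1 => /predU1P[ij|si].
  by exists a.+1, d, chi; split=> // x; rewrite e2 ij e1 exprS mulrA.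
exists a, d.+1, (fun x => b x i * chi x); split; rewrite ?addnS //.
  by exists i, chi.
by move=> x; rewrite e2 e1 mulrCA.
Qed.

(** Once the power of coordinate [j] is below [e], a monomial of degree above [m0 + e] keeps more
    than [m0] factors in [s], to which finiteness over [B] applies. *)
Lemma finite_over_step B j s e :
  homog_integral j s e -> finite_over B s -> finite_over B (j |: s).
Proof.
move=> rel [m0 fin]; exists (m0 + e)%N => m phi m0m.
have ss : s \subset j |: s by apply: subsetUr.
have jjs : j \in j |: s by rewrite setU11.
move=> /monomialU1[a [d [psi [am mpsi /funext->]]]].
apply: fspan_trans (fspan_lower_monomialM (homog_integral_exp a rel) mpsi).
move=> _ [a' [d' [chi [a'e a'd' mchi ->]]]].
have d'gt : (m0 < d')%N.
  rewrite -(ltn_add2l a') a'd' am ltnS (leq_trans _ m0m) // addnC leq_add2l.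
  exact: ltnW.
case: d' a'd' mchi d'gt => // d' a'd' mchi d'gt.
apply: fspan_mul (fin d' chi d'gt mchi) => _ [i [om [iB mom ->]]].
apply: fspan_gen; exists i, (fun x => b x j ^+ a' * om x); split=> //.
  have -> : m = (a' + d')%N by apply: succn_inj; rewrite -am -a'd' addnS.
  by apply: monomialM; [exact: monomialX | exact: monomialS mom].
by apply/funext => x; rewrite mulrCA.
Qed.

End Monomials.

(** * Closures of projected cones *)

Section Elimination.
Variables (K : numClosedFieldType) (T : Type) (M : nat) (b : T -> 'I_M -> K).
Implicit Types (s B : {set 'I_M}) (v w : 'I_M -> K) (f : {mpoly K[M]}).

Definition masked s (x : T) (i : 'I_M) : K := if i \in s then b x i else 0.

(* [v] lies in the Zariski closure of the projection of [b] to the coordinates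
   in [s]; in particular [v i = 0] for [i \notin s]. *)
Definition closure_point s v : Prop :=
  forall f, (forall x, f.@[masked s x] = 0) -> f.@[v] = 0.

Lemma closure_point_notin s v i : closure_point s v -> i \notin s -> v i = 0.
Proof.
move=> sv si; rewrite -(mevalXU v i); apply: sv => x.
by rewrite mevalXU /masked (negPf si).
Qed.

Lemma monomial_mpoly s d psi : monomial b s d psi ->
  exists f, forall x, f.@[masked s x] = psi x.
Proof.
elim: d psi => [|d IH] psi /=.
  by move=> p1; exists 1 => x; rewrite meval1 p1.
move=> [i [chi [si /IH[f fE] e]]]; exists ('X_i * f) => x.
by rewrite mevalM mevalXU fE e /masked si.
Qed.

Lemma fspan_lower_monomial_poly j s e m phi :
  fspan (lower_monomial b j s e m) phi ->
  exists p : {poly {mpoly K[M]}}, (size p <= e)%N /\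
    forall x, (map_poly (meval (masked s x)) p).[b x j] = phi x.
Proof.
elim=> [|c _ psi [a [d [chi [ae _ /monomial_mpoly[f fE] ->]]]] _ [p [sp pE]]].
  by exists 0; rewrite size_poly0; split=> // x; rewrite rmorph0 horner0.
exists ((c *: f)%:P * 'X^a + p); split.
  rewrite (leq_trans (size_polyD _ _)) // geq_max sp andbT mul_polyC.
  by rewrite (leq_trans (size_scale_leq _ _)) // size_polyXn.
move=> x; rewrite rmorphD rmorphM /= map_polyC map_polyXn !hornerE pE /=.
by rewrite mevalZ fE mulrAC.
Qed.

Lemma meval_split (j : 'I_M) f : exists F : {poly {mpoly K[M]}}, forall w t,
  (map_poly (meval w) F).[t] = f.@[fun i => if i == j then t else w i].
Proof.
exists (\sum_(m <- msupp f) (f@_m)%:MP%:P *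
  \prod_i (if i == j then 'X else ('X_i)%:P) ^+ m i) => w t.
rewrite mevalE rmorph_sum horner_sum; apply: eq_bigr => m _.
rewrite rmorphM hornerM /= map_polyC /= mevalC hornerC; congr (_ * _).
rewrite rmorph_prod horner_prod; apply: eq_bigr => i _.
rewrite rmorphXn horner_exp /=; congr (_ ^+ _).
by case: ifP => _; rewrite ?map_polyX ?hornerX // map_polyC hornerC /= mevalXU.
Qed.

(** This is [lying_over] for evaluation at the masked points and at [v], the integral relation
    providing the monic polynomial. *)
Lemma closure_point_lift j s e v :
  homog_integral b j s e -> closure_point s v ->
  exists c, closure_point (j |: s) (fun i => if i == j then c else v i).
Proof.
move=> /fspan_lower_monomial_poly[p [sp pE]] sv.
pose rho x : {rmorphism {mpoly K[M]} -> K} := meval (masked s x).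
have gm : 'X^e - p \is monic.
  by rewrite monicE lead_coefDl ?lead_coefXn // size_polyN size_polyXn ltnS.
have ga x : (map_poly (rho x) ('X^e - p)).[b x j] = 0.
  by rewrite rmorphB /= map_polyXn !hornerE pE subrr.
have [c cP] := @lying_over _ _ _ rho (meval v) (@mpolyC M K) (b^~ j) _
  (mevalC v) gm ga sv.
exists c => f fs; have [F FE] := meval_split j f.
rewrite -FE; apply: cP => x; rewrite FE -[RHS](fs x); apply: meval_eq => i.
by rewrite /masked in_setU1; case: eqVneq => [->|].
Qed.

Lemma masked_monomial s (r : seq 'I_M) (k : 'I_M -> nat) :
  let phi x := \prod_(i <- r) masked s x i ^+ k i in
  phi =1 (fun=> 0) \/ monomial b s (\sum_(i <- r) k i) phi.
Proof.
elim: r => [|i r /= IH]; first by right; rewrite [X in monomial _ _ X]big_nil;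
  move=> x; rewrite big_nil.
have [si|nsi] := boolP (i \in s).
  case: IH => [IH|IH]; first by left=> x; rewrite big_cons IH mulr0.
  right; rewrite big_cons (_ : (fun x => _) = fun x => b x i ^+ k i *
      \prod_(j <- r) masked s x j ^+ k j).
    by apply: monomialM; first exact: monomialX.
  by apply/funext => x; rewrite big_cons /masked si.
have [k0|k_gt0] := posnP (k i).
  case: IH => [IH|IH]; first by left=> x; rewrite big_cons IH mulr0.
  right; rewrite big_cons k0 (_ : (fun x => _) = fun x =>
      \prod_(j <- r) masked s x j ^+ k j) //.
  by apply/funext => x; rewrite big_cons k0 mul1r.
by left=> x; rewrite big_cons /masked (negPf nsi) expr0n gtn_eqF // mul0r.
Qed.

Lemma poly_eq0_nat (p : {poly K}) : (forall n : nat, p.[n%:R] = 0) -> p = 0.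
Proof.
move=> p0; apply/eqP/negPn/negP => pn0.
pose r := [seq i%:R : K | i <- iota 0 (size p)].
have rr : all (root p) r by rewrite all_map; apply/allP => i _; apply/eqP/p0.
have ur : uniq r.
  by rewrite map_inj_uniq ?iota_uniq // => i k /eqP; rewrite eqr_nat => /eqP.
by have := max_poly_roots pn0 rr ur; rewrite size_map size_iota ltnn.
Qed.

Lemma pihomog_scale d (f : {mpoly K[M]}) w (c : K) :
  (pihomog mdeg d f).@[fun i => c * w i] = c ^+ d * (pihomog mdeg d f).@[w].
Proof.
have /dhomogP hd := pihomogP mdeg d f.
rewrite !mevalE mulr_sumr !big_seq; apply: eq_bigr => m /hd/= md.
rewrite mulrCA; congr (_ * _); rewrite -md mdegE -prodrXr -big_split /=.
by apply: eq_bigr => i _; rewrite exprMn.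
Qed.

Hypothesis cone : forall (c : K) x, exists y, forall i, b y i = c * b x i.

(** On a line through the origin [f] is a polynomial in the scaling factor whose coefficients are
    the values of the homogeneous components. It vanishes at all natural numbers, hence is zero. *)
Lemma closure_cone s f d : (forall x, f.@[masked s x] = 0) ->
  forall x, (pihomog mdeg d f).@[masked s x] = 0.
Proof.
move=> f0 x; have [dk|dk] := ltnP d (maxn (msize f) d.+1); last first.
  by move: dk; rewrite leqNgt leq_maxr.
set k := maxn _ _ in dk; have fk := @pihomog_partitionE _ _ mdeg k f.
pose p := \poly_(i < k) (pihomog mdeg i f).@[masked s x].
suff p0 : p = 0 by have := congr1 (fun q : {poly K} => q`_d) p0;
  rewrite coef0 coef_poly dk.
apply: poly_eq0_nat => n; have [y yE] := cone n%:R x.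
rewrite horner_poly -[RHS](f0 y) [in RHS]fk ?leq_maxl // raddf_sum /=.
apply: eq_bigr => i _; rewrite mulrC -pihomog_scale; apply: meval_eq => l.
by rewrite /masked yE; case: ifP; rewrite ?mulr0.
Qed.

(** If the unit point is not in the closure, some form vanishing on the cone is nonzero there, so it
    contains a pure power of ['X_j]. Solving for this power gives the integral relation. *)
Lemma homog_integral_or_closure_point j s : j \notin s ->
  (exists e, homog_integral b j s e) \/
  closure_point (j |: s) (fun i => (i == j)%:R).
Proof.
move=> js.
have [|npt] := pselect (closure_point (j |: s) (fun i => (i == j)%:R)).
  by right.
left; have [f nf] : exists f, ~ ((forall x, f.@[masked (j |: s) x] = 0) ->
    f.@[fun i => (i == j)%:R] = 0) by apply/existsNP.
have {nf npt} [f0 fj] := (not_implyP _ _).1 nf.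
have [e ej] : exists e, (pihomog mdeg e f).@[fun i => (i == j)%:R] != 0.
  apply/not_existsP => n0; apply: fj.
  rewrite (@pihomog_partitionE _ _ mdeg (msize f) f) // raddf_sum big1 //=.
  move=> i _.
  by apply/eqP/negPn/negP => /n0.
have h0 := closure_cone e f0.
have hd : {in msupp (pihomog mdeg e f), forall m, mdeg m = e}.
  exact/dhomogP/pihomogP.
set h := pihomog mdeg e f in ej h0 hd.
exists e; pose u : 'X_{1..M} := (U_(j) *+ e)%MM.
have uE m : m \in msupp h -> m != u -> exists2 i, i != j & m i != 0%N.
  move=> mh mu; apply/exists2P/not_existsP => al; case/negP: mu.
  have m0 i : i != j -> m i = 0%N.
    by move=> ij; apply/eqP/negPn/negP => mi; apply: (al i).
  apply/eqP/mnmP => i; rewrite mulmnE mnm1E -(hd _ mh) mdegE (bigD1 j) //=.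
  rewrite big1 ?addn0 // eq_sym.
  by have [->|/m0] := eqVneq i j; rewrite ?mul1n.
have jE m : m \in msupp h ->
    (m j + \sum_(i <- [seq i <- enum 'I_M | i != j]) m i)%N = e.
  by move=> /hd <-; rewrite mdegE (bigD1 j) //= big_filter big_enum_cond.
have hu : h@_u != 0.
  apply: contraNneq ej => hu; rewrite mevalE big_seq big1 // => m mh.
  have [->|/(uE _ mh)[i ij mi]] := eqVneq m u; first by rewrite hu mul0r.
  by rewrite (bigD1 i) //= (negPf ij) expr0n (negPf mi) mul0r mulr0.
have uh : u \in msupp h by rewrite mcoeff_msupp.
have u_val x : \prod_i masked (j |: s) x i ^+ u i = b x j ^+ e.
  rewrite (bigD1 j) //= big1 => [|i ij]; last by rewrite mulmnE mnm1E eq_sym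
    (negPf ij).
  by rewrite mulmnE mnm1E eqxx mul1n mulr1 /masked setU11.
rewrite /homog_integral.
apply: (@eq_fspan _ _ _ (fun x => - (h@_u)^-1 * \sum_(m <- msupp h | m != u)
    h@_m * \prod_i masked (j |: s) x i ^+ m i)) => [x|].
  have := h0 x; rewrite mevalE (bigD1_seq u) ?msupp_uniq //= u_val => /eqP.
  rewrite addr_eq0 => /eqP/(canRL (mulKf hu)) ->.
  by rewrite mulrN mulNr.
apply: fspan_scale; rewrite (_ : (fun x => _) = fun x => \sum_(m <- msupp h |
    (m \in msupp h) && (m != u)) h@_m * \prod_i masked (j |: s) x i ^+ m i);
      last first.
  by apply/funext => x; rewrite big_seq_cond.
apply: fspan_sum => m /andP[mh mu]; apply: fspan_scale.
pose r := [seq i <- enum 'I_M | i != j].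
apply: (@eq_fspan _ _ _ (fun x =>
    b x j ^+ m j * \prod_(i <- r) masked s x i ^+ m i)).
  move=> x; rewrite [RHS](bigD1 j) //= big_filter big_enum_cond /= /masked
    setU11.
  congr (_ * _); apply: eq_bigr => i ij.
  by rewrite in_setU1 (negPf ij).
have [phi0|mphi] := masked_monomial s r m.
  by apply: eq_fspan (fspan0 _) => x; rewrite phi0 mulr0.
apply: fspan_gen; exists (m j), (\sum_(i <- r) m i)%N,
  (fun x => \prod_(i <- r) masked s x i ^+ m i).
split=> //; last exact: jE.
rewrite -(jE _ mh) -[X in (X < _)%N]addn0 ltn_add2l lt0n sum_nat_seq_neq0.
have [i ij mi] := uE _ mh mu; apply/hasP; exists i; rewrite ?mi //.
by rewrite mem_filter ij mem_enum.
Qed.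

End Elimination.
(** The coordinates are adjoined to [B] one at a time. At each new one, either its unit point lies
    in the closure and vanishes on [B], or an integral relation carries finiteness, or a point
    already found, one step further. *)
Lemma elimination (K : numClosedFieldType) (T : Type) (M : nat)
    (b : T -> 'I_M -> K) (B : {set 'I_M}) :
    (forall (c : K) x, exists y, forall i, b y i = c * b x i) ->
  finite_over b B setT \/
  exists v : 'I_M -> K, [/\ exists i, v i != 0, {in B, forall i, v i = 0}
    & closure_point b setT v].
Proof.
move=> cone; have -> : [set: 'I_M] = B :|: [set i in enum 'I_M].
  by apply/setP => i; rewrite !inE mem_enum orbT.
elim: (enum _) => [|j r IH].
  left; rewrite (_ : _ :|: _ = B); first exact: finite_over_refl.
  by apply/setP => i; rewrite !inE orbF.
have -> : B :|: [set i in j :: r] = j |: (B :|: [set i in r]).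
  by apply/setP => i; rewrite !inE orbCA.
set s := B :|: _ in IH *; have [js|js] := boolP (j \in s).
  by rewrite (setUidPr _) ?sub1set.
have nB i : i \in B -> i != j.
  by move=> iB; apply: contraNneq js => <-; rewrite /s inE iB.
have [[e rel]|pj] := homog_integral_or_closure_point cone js; last first.
  right; exists (fun i => (i == j)%:R); split=> //.
    by exists j; rewrite eqxx oner_eq0.
  by move=> i /nB/negPf->.
case: IH => [fin|[v [[i vi] vB sv]]].
  by left; exact: finite_over_step rel fin.
have [c cP] := closure_point_lift rel sv.
right; exists (fun i => if i == j then c else v i); split=> //.
  exists i; rewrite /=; have [ij|//] := eqVneq i j; case/negP: vi.
  by rewrite ij (closure_point_notin sv js).
by move=> l lB; rewrite /= (negPf (nB _ lB)) vB.
Qed.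

(** * Counting monomials against algebraic independence *)

Lemma linear_dependence (K : fieldType) (T : Type) (I J : finType)
    (F : I -> T -> K) (G : J -> T -> K) :
    (#|J| < #|I|)%N ->
    (forall i, exists c : J -> K, forall x, F i x = \sum_j c j * G j x) ->
  exists u : I -> K, (exists i, u i != 0) /\ forall x, \sum_i u i * F i x = 0.
Proof.
move=> JI /choice[c cE].
pose A := \matrix_(i < #|I|, j < #|J|) c (enum_val i) (enum_val j).
have /rowV0Pn[u /sub_kermxP uA u0] : kermx A != 0.
  by rewrite -mxrank_eq0 mxrank_ker subn_eq0 -ltnNge (leq_ltn_trans
    (rank_leq_col _)).
exists (fun i => u 0 (enum_rank i)); split.
  have /rV0Pn[k uk] := u0.
  by exists (enum_val k); rewrite enum_valK.
move=> x; under eq_bigr => i _ do rewrite cE mulr_sumr.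
rewrite exchange_big big1 //= => j _.
under eq_bigr => i _ do rewrite mulrA.
rewrite -mulr_suml; suff -> : \sum_i u 0 (enum_rank i) * c i j = 0 by rewrite
  mul0r.
have := congr1 (fun w : 'rV_ _ => w 0 (enum_rank j)) uA; rewrite !mxE => uAj.
rewrite -[RHS]uAj (reindex _ (onW_bij _ (@enum_val_bij I))) /=.
by apply: eq_bigr => i _; rewrite enum_valK mxE enum_rankK.
Qed.

Section Counting.
Variables (K : fieldType) (T : Type) (M : nat) (b : T -> 'I_M -> K).
Variables (B : {set 'I_M}) (m0 : nat).

(** The number of choices for [gamma] does not depend on [Q], so these monomials number at most a
    constant times [Q ^ #|B|]. *)
Definition bounded_monomial (Q : nat) (phi : T -> K) : Prop :=
  exists (beta : 'I_#|B| -> nat) (gamma : 'I_M -> nat),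
  [/\ forall k, (beta k < Q)%N, forall i, (gamma i <= m0)%N
    & phi = fun x => \prod_k b x (enum_val k) ^+ beta k *
                     \prod_i b x i ^+ gamma i].

Lemma monomial_exponent s m phi : monomial b s m phi ->
  exists gamma : 'I_M -> nat, (\sum_i gamma i)%N = m /\
    phi = fun x => \prod_i b x i ^+ gamma i.
Proof.
elim: m phi => [|m IH] phi /=.
  move=> p1; exists (fun=> 0%N); split; first by rewrite big1.
  by apply/funext => x; rewrite p1 big1.
move=> [i [psi [_ /IH[g [gm ->]] e]]].
exists (fun j => ((j == i) + g j)%N); split.
  by rewrite big_split /= gm (bigD1 i) //= eqxx big1 // => j /negPf->.
apply/funext => x; rewrite e; under [RHS]eq_bigr do rewrite exprD.
rewrite big_split /= [X in _ = X * _](bigD1 i) //= eqxx.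
rewrite [X in _ = _ * X * _]big1 ?mulr1 //.
by move=> j /negPf->.
Qed.

Lemma bounded_monomialM Q i phi : i \in B -> bounded_monomial Q phi ->
  bounded_monomial Q.+1 (fun x => b x i * phi x).
Proof.
move=> iB [beta [gamma [bQ gm ->]]]; pose k0 := enum_rank_in iB i.
exists (fun k => ((k == k0) + beta k)%N), gamma; split=> //.
  by move=> k; rewrite ltnS (leq_trans _ (bQ k)) //; case: (k == k0).
apply/funext => x; rewrite mulrA; congr (_ * _).
under [RHS]eq_bigr do rewrite exprD.
rewrite big_split /= [X in _ = X * _](bigD1 k0) //= eqxx.
rewrite [X in _ = _ * X * _]big1 ?mulr1.
  by rewrite enum_rankK_in.
by move=> j /negPf->.
Qed.

Lemma bounded_monomial_mono Q Q' phi :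
  (Q <= Q')%N -> bounded_monomial Q phi -> bounded_monomial Q' phi.
Proof.
move=> QQ [beta [gamma [bQ gm ->]]]; exists beta, gamma; split=> // k.
exact: leq_trans (bQ k) QQ.
Qed.

Lemma monomial_fspan :
    (forall m phi, (m0 <= m)%N -> monomial b setT m.+1 phi ->
      fspan (reducible b B setT m) phi) ->
  forall m phi, monomial b setT m phi -> fspan (bounded_monomial m.+1) phi.
Proof.
move=> fin.
have small m phi : (m <= m0)%N -> monomial b setT m phi ->
    fspan (bounded_monomial m.+1) phi.
  move=> mm0 /monomial_exponent[g [gm ->]].
  apply: fspan_gen; exists (fun=> 0%N), g; split=> //.
    by move=> i; rewrite (leq_trans _ mm0) // -gm (bigD1 i) ?leq_addr.
  by apply/funext => x; rewrite [X in _ = X * _]big1 ?mul1r.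
elim=> [|m IH] phi mphi; first exact: small.
have [m0m|mm0] := leqP m0 m; last exact: small.
apply: fspan_trans (fin _ _ m0m mphi) => _ [i [psi [iB /IH spsi ->]]].
by apply: fspan_mul spsi => chi bchi; apply: fspan_gen;
  exact: bounded_monomialM.
Qed.

Lemma fspan_bounded_monomial Q phi : fspan (bounded_monomial Q) phi ->
  exists c : {ffun 'I_#|B| -> 'I_Q} * {ffun 'I_M -> 'I_m0.+1} -> K,
  forall x, phi x = \sum_w c w *
    (\prod_k b x (enum_val k) ^+ w.1 k * \prod_i b x i ^+ w.2 i).
Proof.
elim=> [|d psi chi [beta [gamma [bQ gm ->]]] _ [c cE]].
  by exists (fun=> 0) => x; rewrite big1 // => w _; rewrite mul0r.
pose w0 := ([ffun k => Ordinal (bQ k)],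
  [ffun i => Ordinal (gm i : gamma i < m0.+1)%N]).
exists (fun w => (w == w0)%:R * d + c w) => x.
under [RHS]eq_bigr do rewrite mulrDl.
rewrite big_split /= -cE; congr (_ + _).
rewrite (bigD1 w0) //= eqxx mul1r [X in _ = _ + X]big1 ?addr0.
  by congr (_ * (_ * _)); apply: eq_bigr => i _; rewrite ffunE.
by move=> w /negPf->; rewrite !mul0r.
Qed.

End Counting.

(** Algebraic independence: a polynomial relation is given by its coefficients, all exponents being
    below some [q]. *)
Definition coord_independent (K : comNzRingType) (T : Type) (M : nat)
    (b : T -> 'I_M -> K) (J : finType) (y : J -> 'I_M) : Prop :=
  forall q (c : {ffun J -> 'I_q} -> K),
    (forall x, \sum_a c a * \prod_j b x (y j) ^+ a j = 0) -> forall a, c a = 0.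

Lemma monomial_prod (K : comNzRingType) (T : Type) (M : nat)
    (b : T -> 'I_M -> K) (I : Type) (r : seq I) (y : I -> 'I_M) (a : I -> nat) :
  monomial b setT (\sum_(i <- r) a i)
    (fun x => \prod_(i <- r) b x (y i) ^+ a i).
Proof.
elim: r => [|i r IH].
  by rewrite [X in monomial _ _ X]big_nil => x; rewrite big_nil.
rewrite big_cons (_ : (fun x => _) = fun x => b x (y i) ^+ a i *
  \prod_(j <- r) b x (y j) ^+ a j); last by apply/funext => x; rewrite big_cons.
by apply: monomialM => //; apply: monomialX; rewrite inE.
Qed.

Lemma finite_over_independent (K : fieldType) (T : Type) (M : nat)
    (b : T -> 'I_M -> K) (B : {set 'I_M}) (J : finType) (y : J -> 'I_M) :
  finite_over b B setT -> coord_independent b y -> (#|J| <= #|B|)%N.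
Proof.
move=> [m0 fin] ind; rewrite leqNgt; apply/negP => BJ.
(* [E] counts the [gamma], [Q] exceeds the degree of every monomial with exponents below [q], and
   [q] is so large that [E * Q ^ #|B| < q ^ #|J|]. *)
pose E := (m0.+1 ^ M)%N; pose q := (E * #|J|.+1 ^ #|B|).+1.
pose Q := (#|J| * q).+1.
have card : (#|{: {ffun 'I_#|B| -> 'I_Q} * {ffun 'I_M -> 'I_m0.+1}}|
             < #|{ffun J -> 'I_q}|)%N.
  rewrite card_prod !card_ffun !card_ord -/E.
  have h1 : (Q ^ #|B| <= #|J|.+1 ^ #|B| * q ^ #|B|)%N.
    have [->|B0] := posnP #|B|; first by rewrite !expn0.
    by rewrite -expnMn leq_exp2r // /Q mulSn -add1n leq_add2r.
  have h2 : (E * (#|J|.+1 ^ #|B| * q ^ #|B|) < q ^ #|B|.+1)%N.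
    by rewrite mulnA expnS ltn_pmul2r ?expn_gt0 //.
  rewrite mulnC (leq_ltn_trans _ (leq_trans h2 _)) ?leq_mul2l ?h1 ?orbT //.
  by rewrite leq_pexp2l.
have dep (a : {ffun J -> 'I_q}) :
    fspan (bounded_monomial b B m0 Q) (fun x => \prod_j b x (y j) ^+ a j).
  have := monomial_fspan fin (monomial_prod b (index_enum J) y (fun j => a j)).
  apply: fspan_trans => psi /(bounded_monomial_mono (Q' := Q)) bm.
  apply: fspan_gen; apply: bm; rewrite ltnS -sum1_card big_distrl /=.
  by apply: leq_sum => j _; rewrite mul1n ltnW.
have [u [[a ua] uF]] :=
  linear_dependence card (fun a => fspan_bounded_monomial (dep a)).
by case/negP: ua; apply/eqP; apply: ind uF a.
Qed.

Theorem projective_dimension (K : numClosedFieldType) (T : Type) (M : nat)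
    (b : T -> 'I_M -> K) (B : {set 'I_M}) (J : finType) (y : J -> 'I_M) :
    (forall (c : K) x, exists y, forall i, b y i = c * b x i) ->
    coord_independent b y -> (#|B| < #|J|)%N ->
  exists v : 'I_M -> K, [/\ exists i, v i != 0, {in B, forall i, v i = 0}
    & forall f : {mpoly K[M]}, (forall x, f.@[b x] = 0) -> f.@[v] = 0].
Proof.
move=> cone ind BJ; have [fin|[v [v0 vB cv]]] := elimination B cone.
  by have := finite_over_independent fin ind; rewrite leqNgt BJ.
exists v; split=> // f f0; apply: cv => x; rewrite -[RHS](f0 x).
by apply: meval_eq => i; rewrite /masked in_setT.
Qed.

(** * Determinants and permanents *)

(** Summing the relations against the tensor product of the inverse Vandermonde matrices isolates
    each coefficient. *)
Lemma tensor_vandermonde (K : fieldType) (J : finType) (q : nat)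
    (s : J -> 'I_q -> K) (c : {ffun J -> 'I_q} -> K) :
    (forall j, injective (s j)) ->
    (forall p : {ffun J -> 'I_q},
      \sum_a c a * \prod_j s j (p j) ^+ a j = 0) ->
  forall a, c a = 0.
Proof.
move=> sinj c0 a0; pose V j := Vandermonde q (\row_i s j i).
have Vu j : V j \in unitmx.
  rewrite unitmxE unitfE det_Vandermonde.
  apply/prodf_neq0 => i _; apply/prodf_neq0 => k ik; rewrite !mxE subr_eq0.
  by apply: contraTneq ik => /sinj ->; rewrite ltnn.
have VK j (i k : 'I_q) : \sum_l s j l ^+ i * invmx (V j) l k = (i == k)%:R.
  have := congr1 (fun A : 'M_q => A i k) (mulmxV (Vu j)); rewrite !mxE => <-.
  by apply: eq_bigr => l _; rewrite !mxE.
have e : \sum_(p : {ffun J -> 'I_q}) (\sum_a c a * \prod_j s j (p j) ^+ a j) *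
    \prod_j invmx (V j) (p j) (a0 j) = 0.
  by rewrite big1 // => p _; rewrite c0 mul0r.
rewrite -[RHS]e; under eq_bigr do rewrite mulr_suml.
rewrite exchange_big (bigD1 a0) //= [X in _ = _ + X]big1 ?addr0 => [|a aa0].
  under eq_bigr do rewrite -mulrA -big_split /=.
  rewrite -mulr_sumr -(bigA_distr_bigA (fun j l => s j l ^+ a0 j * invmx (V j) l
    (a0 j))).
  by rewrite big1 ?mulr1 // => j _; rewrite VK eqxx.
under eq_bigr do rewrite -mulrA -big_split /=.
rewrite -mulr_sumr -(bigA_distr_bigA (fun j l => s j l ^+ a j * invmx (V j) l
  (a0 j))).
have [j ja] : exists j, a j != a0 j.
  apply/existsP; rewrite -negb_forall; apply: contra aa0 => /forallP aa0.
  by apply/eqP/ffunP => j; apply/eqP.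
by rewrite (bigD1 j) //= VK -val_eqE /= in ja *; rewrite (negPf ja) mul0r mulr0.
Qed.

Lemma exists_perm_mem (T : finType) (A B : {set T}) : #|A| = #|B| ->
  exists s : {perm T}, forall x, (s x \in B) = (x \in A).
Proof.
move=> AB; pose l (C : {set T}) := enum C ++ enum (~: C).
have lu C : uniq (l C).
  rewrite cat_uniq !enum_uniq /= andbT; apply/hasPn => x.
  by rewrite !mem_enum inE.
have lm C x : x \in l C by rewrite mem_cat !mem_enum inE orbN.
have ls C : size (l C) = #|T| by rewrite size_cat -!cardE cardsC.
pose f x := nth x (l B) (index x (l A)).
have fi x : (index x (l A) < size (l B))%N by rewrite ls -(ls A) index_mem lm.
have finj : injective f.
  move=> x y /eqP; rewrite /f (set_nth_default y) // nth_uniq //.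
  by move=> /eqP ixy; rewrite -(nth_index x (lm A x)) ixy nth_index.
exists (perm finj) => x; rewrite permE /f.
have -> : (x \in A) = (index x (l A) < #|A|)%N.
  by rewrite index_cat mem_enum cardE; case: ifP => xA;
    [rewrite index_mem mem_enum xA | rewrite ltnNge leq_addr].
rewrite AB nth_cat -cardE; case: ltnP => ixB.
  by rewrite -mem_enum mem_nth // -cardE.
have : nth x (enum (~: B)) (index x (l A) - #|B|) \in enum (~: B).
  by rewrite mem_nth // -cardE ltn_subLR // cardsC -(ls B).
by rewrite mem_enum inE => /negPf.
Qed.

(** * Signed permanents of matrix pencils *)

Section SignedPermanent.
Variable n : nat.

(* The determinant ([e] the parity) and the permanent ([e = false]) at once. *)
Definition signed_perm (R : comNzRingType) (e : 'S_n -> bool)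
    (A : 'M[R]_n) : R :=
  \sum_s (-1) ^+ e s * \prod_i A i (s i).

Lemma rmorph_signed_perm (R S : comNzRingType) (h : {rmorphism R -> S}) e A :
  h (signed_perm e A) = signed_perm e (map_mx h A).
Proof.
rewrite rmorph_sum; apply: eq_bigr => s _.
rewrite rmorphM rmorphXn rmorphN1 rmorph_prod; congr (_ * _).
by apply: eq_bigr => i _; rewrite mxE.
Qed.

Lemma signed_perm_row0 (R : comNzRingType) e (A : 'M[R]_n) i :
  (forall j, A i j = 0) -> signed_perm e A = 0.
Proof.
by move=> A0; rewrite /signed_perm big1 // => s _;
  rewrite (bigD1 i) //= A0 mul0r mulr0.
Qed.

Lemma signed_perm_col0 (R : comNzRingType) e (A : 'M[R]_n) j :
  (forall i, A i j = 0) -> signed_perm e A = 0.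
Proof.
move=> A0; rewrite /signed_perm big1 // => s _.
by rewrite (bigD1 (s^-1%g j)) //= permKV A0 mul0r mulr0.
Qed.

(** A permutation agreeing with [s] off [i] equals [s], so row [i] may be left arbitrary. *)
Lemma signed_perm_monomial (R : comNzRingType) e (A : 'M[R]_n)
    (s : 'S_n) (i : 'I_n) :
  (forall k j, k != i -> j != s k -> A k j = 0) ->
  signed_perm e A = (-1) ^+ e s * \prod_i A i (s i).
Proof.
move=> A0; rewrite /signed_perm (bigD1 s) //= [X in _ + X]big1 ?addr0 //.
move=> t ts.
have [k ki kt] : exists2 k, k != i & t k != s k.
  apply/exists2P/not_existsP => al; case/negP: ts.
  have st k : k != i -> t k = s k.
    by move=> ki; apply/eqP/negPn/negP => kt; apply: (al k).
  apply/eqP/permP => k; have [->{k}|/st//] := eqVneq k i.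
  have [tsi|ki] := eqVneq (t^-1%g (s i)) i; first by rewrite -{1}tsi permKV.
  by have := st _ ki; rewrite permKV => /perm_inj ski; rewrite -ski eqxx in ki.
by rewrite (bigD1 k) //= A0 // mul0r mulr0.
Qed.

Definition pencil (K : comNzRingType) (x y : 'M[K]_n) : 'M[{poly K}]_n :=
  map_mx polyC x + 'X *: map_mx polyC y.

Lemma pencilE (K : comNzRingType) (x y : 'M[K]_n) i j :
  pencil x y i j = (x i j)%:P + 'X * (y i j)%:P.
Proof. by rewrite !mxE. Qed.

(** Every row in [I] contributes a factor ['X], so only degrees at least [#|I|] occur. *)
Lemma signed_perm_pencil0 (K : comNzRingType) e (x y : 'M[K]_n)
    (I : {set 'I_n}) b :
  (b < #|I|)%N -> (forall i j, i \in I -> x i j = 0) ->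
  (signed_perm e (pencil x y))`_b = 0.
Proof.
move=> bI x0; rewrite coef_sum big1 // => s _.
rewrite -signr_odd mulr_sign; suff c0 : (\prod_i pencil x y i (s i))`_b = 0.
  by case: ifP; rewrite ?coefN c0 ?oppr0.
rewrite (bigID (mem I)) /= (eq_bigr (fun i => 'X * (y i (s i))%:P)).
  by rewrite big_split /= prodr_const -mulrA coefXnM bI.
by move=> i iI; rewrite pencilE x0 // add0r.
Qed.

Lemma pencil_horner (K : comNzRingType) e (x y : 'M[K]_n) (t : K) :
  (signed_perm e (pencil x y)).[t] = signed_perm e (x + t *: y).
Proof.
rewrite -[LHS]/(horner_eval t _) rmorph_signed_perm; congr signed_perm.
by apply/matrixP => i j; rewrite !mxE /= /horner_eval !hornerE.
Qed.

Lemma signed_perm_concise (K : fieldType) e (v : 'M[K]_n) :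
  (forall x, signed_perm e (x + v) = signed_perm e x) -> v = 0.
Proof.
move=> H; apply/matrixP => i j; rewrite [RHS]mxE; apply/eqP/negPn/negP => vij.
(* [s] sends [i] to [j]. Off row [i] the matrix [x + v] is that of [s], so its value is [v i j] up
   to sign, while [x] has a zero row. *)
pose s := tperm i j.
pose x := \matrix_(k, l) (if k == i then 0 else (l == s k)%:R - v k l).
have : signed_perm e x = 0.
  by apply: (@signed_perm_row0 _ _ _ i) => l; rewrite mxE eqxx.
rewrite -H; suff -> : signed_perm e (x + v) = (-1) ^+ e s * v i j.
  by move/eqP; rewrite mulf_eq0 expf_eq0 oppr_eq0 oner_eq0 andbF (negPf vij).
rewrite (@signed_perm_monomial _ _ _ s i) => [|k l ki ls].
  congr (_ * _); rewrite (bigD1 i) //= big1 => [|k ki].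
    by rewrite !mxE eqxx add0r mulr1 /s tpermL.
  by rewrite !mxE (negPf ki) eqxx subrK.
by rewrite !mxE (negPf ki) (negPf ls) sub0r addNr.
Qed.

End SignedPermanent.

(** * The catalecticant bound *)

Lemma linear_formE (K : comNzRingType) (m : nat) (l : {mpoly K[m]}) :
  l \is 1.-homog -> l = \sum_p l@_U_(p) *: 'X_p.
Proof.
move=> hl; apply/mpolyP => k; rewrite raddf_sum /=.
under eq_bigr do rewrite mcoeffZ mcoeffX.
have [/mdeg1P[i /eqP->]|dk] := boolP (mdeg k == 1%N).
  rewrite (bigD1 i) //= eqxx mulr1 big1 ?addr0 // => j ji.
  suff /negPf-> : U_(j)%MM != U_(i)%MM :> 'X_{1..m} by rewrite mulr0.
  apply: contra ji => /eqP/mnmP/(_ j).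
  by rewrite !mnm1E eqxx eq_sym; case: (j == i).
rewrite (dhomog_nemf_coeff hl) // big1 // => j _.
by have [jk|_] := eqVneq U_(j)%MM k; rewrite ?mulr0 //; rewrite -jk mdeg1 in dk.
Qed.

Section LowerBound.
Variables (K : numFieldType) (n r : nat) (e : 'S_n -> bool).

(** Column [i] of [C] lists the coefficients of the [i]-th linear form. The identity on pencils
    yields both coefficients in the parameter and, by evaluation, values along lines. *)
Definition powers_matrix (C : 'M[K]_(n * n, r)) : Prop := forall x y : 'M[K]_n,
  signed_perm e (pencil x y) = \sum_i
    (((mxvec x *m C) 0 i)%:P + 'X * ((mxvec y *m C) 0 i)%:P) ^+ n.

Lemma sum_of_powers_matrix :
  sum_of_powers n (signed_perm e (generic_matrix K n)) r ->
  exists C, powers_matrix C.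
Proof.
move=> [l [hl lE]]; exists (\matrix_(p, i) (l i)@_U_(p)) => x y.
pose h p : {poly K} := (mxvec x 0 p)%:P + 'X * (mxvec y 0 p)%:P.
pose ev : {rmorphism {mpoly K[n * n]} -> {poly K}} := mmap polyC h.
have -> : pencil x y = map_mx ev (generic_matrix K n).
  apply/matrixP => i j; rewrite pencilE !mxE /= mmapX mmap1U /h.
  by rewrite !mxvecE.
rewrite -rmorph_signed_perm lE rmorph_sum; apply: eq_bigr => i _.
rewrite rmorphXn; congr (_ ^+ n); rewrite {1}[l i](linear_formE (hl i))
  rmorph_sum /=.
rewrite !mxE !rmorph_sum mulr_sumr -big_split /=; apply: eq_bigr => p _.
rewrite mmapZ mmapX mmap1U /h !mxE !rmorphM /=.
by rewrite mulrDr [_%:P * _]mulrC; congr (_ + _);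
  rewrite mulrCA [_%:P * _]mulrC.
Qed.

Lemma coef_linear_exp (p q : K) (a b d : nat) : (a + b = d)%N ->
  ((p%:P + 'X * q%:P) ^+ d)`_b = (p ^+ a * q ^+ b) *+ 'C(d, b).
Proof.
move=> <-; rewrite exprDn coef_sum (bigD1 (inord b)) //= big1 ?addr0.
  rewrite inordK ?ltnS ?leq_addl // addnK exprMn coefMn -!rmorphXn /=.
  by rewrite mul_polyC coefZ coefXnM ltnn subnn coefC eqxx.
move=> i ib; rewrite coefMn exprMn -!rmorphXn /= mul_polyC coefZ coefXnM.
have {}ib : (i : nat) != b.
  by move: ib; rewrite -val_eqE /= inordK ?ltnS ?leq_addl.
case: ltnP => bi; first by rewrite mulr0 mul0rn.
by rewrite coefC subn_eq0 leqNgt ltn_neqAle ib bi mulr0 mul0rn.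
Qed.

(* The left kernel of the catalecticant [Y] contains the vectors
   [(<z, c_i> ^ a)_i] for [z] in [Z]; a vector of this kernel is determined by
   its entries at some [r - \rank Y] places, each of which vanishes as soon as
   one linear condition on [z] holds. *)
Lemma catalecticant_bound (C : 'M[K]_(n * n, r)) (a b D : nat) (Q : finType)
    (X Y : Q -> 'M[K]_n) (Z : 'M[K]_n -> Prop) :
    powers_matrix C -> (a + b = n)%N -> (0 < a)%N ->
    (forall i j, ((signed_perm e (pencil (X i) (Y j)))`_b == 0) = (i != j)) ->
    (forall z j, Z z -> (signed_perm e (pencil z (Y j)))`_b = 0) ->
    (forall k (G : 'M[K]_(n * n, k)), (k < D)%N ->
       exists z, [/\ Z z, z != 0 & mxvec z *m G = 0]) ->
  (#|Q| + D <= r)%N.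
Proof.
move=> CE abn a_gt0 XY ZY ZD.
pose ell (x : 'M[K]_n) i : K := (mxvec x *m C) 0 i.
have binN0 : 'C(n, b)%:R != 0 :> K.
  by rewrite pnatr_eq0 -lt0n bin_gt0 -abn leq_addl.
have coefE x y : (signed_perm e (pencil x y))`_b =
    (\sum_i ell x i ^+ a * ell y i ^+ b) *+ 'C(n, b).
  rewrite CE coef_sum -sumrMnl; apply: eq_bigr => i _.
  by rewrite (coef_linear_exp _ _ abn).
have coef0 x y : ((signed_perm e (pencil x y))`_b == 0) =
    (\sum_i ell x i ^+ a * ell y i ^+ b == 0).
  by rewrite coefE -mulr_natr mulf_eq0 (negPf binN0) orbF.
pose XM := \matrix_(q < #|Q|, i < r) ell (X (enum_val q)) i ^+ a.
pose YM := \matrix_(i < r, q < #|Q|) ell (Y (enum_val q)) i ^+ b.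
have XYE q q' : (XM *m YM) q q' =
    \sum_i ell (X (enum_val q)) i ^+ a * ell (Y (enum_val q')) i ^+ b.
  by rewrite mxE; apply: eq_bigr => i _; rewrite !mxE.
have rkY : (\rank YM = #|Q|)%N.
  apply/eqP; rewrite eqn_leq rank_leq_col /=.
  rewrite -{1}(@mxrank_unit _ _ (XM *m YM)) ?mxrankM_maxr //.
  have -> : XM *m YM = diag_mx (\row_q (XM *m YM) q q).
    apply/matrixP => q q'; rewrite [RHS]mxE; case: eqVneq => [<-|qq'].
      by rewrite mulr1n [RHS]mxE.
    rewrite mulr0n XYE; apply/eqP; rewrite -coef0 XY.
    by apply: contraNneq qq' => /enum_val_inj ->.
  rewrite unitmxE unitfE det_diag; apply/prodf_neq0 => q _.
  by rewrite mxE XYE -coef0 XY eqxx.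
pose k := \rank (kermx YM); have kE : (k = r - #|Q|)%N
  by rewrite /k mxrank_ker rkY.
have Qr : (#|Q| <= r)%N by rewrite -rkY rank_leq_row.
rewrite -leq_subRL // -kE leqNgt; apply/negP => kD.
pose W := row_base (kermx YM).
have Wf : row_full W^T by rewrite /row_full mxrank_tr eq_row_base.
pose f := fullrankfun Wf.
have Wu : colsub f W \in unitmx.
  by rewrite -unitmx_tr trmx_mxsub fullrowsub_unit.
have [z [Zz z0 zG]] := ZD _ (colsub f C) kD.
case/eqP: z0.
pose u := \row_i ell z i ^+ a.
have uk : (u <= kermx YM)%MS.
  apply/sub_kermxP/matrixP => o q; rewrite !mxE.
  apply/eqP; under eq_bigr do rewrite !mxE.
  by rewrite -coef0 ZY.
have [t ut] : exists t, u = t *m W.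
  by apply/submxP; rewrite eq_row_base.
have t0 : t = 0.
  rewrite -[t](mulmxK Wu) mulmx_colsub -ut.
  suff -> : colsub f u = 0 by rewrite mul0mx.
  apply/rowP => i; rewrite !mxE; move/rowP/(_ i): zG; rewrite mulmx_colsub mxE.
  by rewrite [RHS]mxE => zi; rewrite /ell zi expr0n gtn_eqF.
have zC : mxvec z *m C = 0.
  apply/rowP => i; rewrite [RHS]mxE.
  have : u 0 i = 0 by rewrite ut t0 mul0mx mxE.
  by rewrite mxE => /eqP; rewrite expf_eq0 a_gt0 => /eqP.
(* All linear forms vanish at [z], so translation by [z] changes no value and [z] must be zero. *)
apply: (@signed_perm_concise _ _ e) => x.
have h t' : signed_perm e (x + t' *: z) = \sum_i ell x i ^+ n.
  rewrite -pencil_horner CE horner_sum; apply: eq_bigr => i _.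
  by rewrite zC [(0 : 'rV_ _) 0 i]mxE horner_exp !hornerE.
by rewrite -[z]scale1r h -(h 0) scale0r addr0.
Qed.

End LowerBound.

(** The index set consists of pairs of [a]-subsets, of rows and of columns; [X w] is the partial
    permutation matrix of [s w] on the chosen rows, [Y w] that on the others. For distinct pairs the
    pencil has a zero row or column; for equal ones its value is ['X^b] up to sign. *)
Lemma subset_pair_pencil (K : numFieldType) (n a b : nat) (e : 'S_n -> bool) :
    (a + b = n)%N -> (0 < n)%N ->
  exists (Q : finType) (X Y : Q -> 'M[K]_n), #|Q| = ('C(n, b) ^ 2)%N /\
    forall i j, ((signed_perm e (pencil (X i) (Y j)))`_b == 0) = (i != j).
Proof.
move=> abn n_gt0; pose S : finType := {I : {set 'I_n} | #|I| == a}.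
have sP (w : S * S) : exists s : 'S_n, forall i,
    (s i \in val w.2) = (i \in val w.1).
  by apply: exists_perm_mem; rewrite (eqP (valP w.1)) (eqP (valP w.2)).
have [s sE] := choice sP.
pose X (w : S * S) : 'M[K]_n :=
  \matrix_(i, j) ((i \in val w.1) && (j == s w i))%:R.
pose Y (w : S * S) : 'M[K]_n :=
  \matrix_(i, j) ((i \notin val w.1) && (j == s w i))%:R.
exists (S * S)%type, X, Y; split.
  have cS : #|{: S}| = 'C(n, b).
    rewrite card_sig -(card_ord n) -bin_sub ?card_ord -?abn ?leq_addl //.
    rewrite addnK abn -[in RHS](card_ord n) -card_draws; apply: eq_card => I.
    by rewrite !inE.
  by rewrite card_prod cS mulnn.
have sepP (I J : S) : I != J -> exists2 i, i \in val J & i \notin val I.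
  move=> IJ; apply/subsetPn; apply: contra IJ => JI.
  by rewrite eq_sym -val_eqE eqEcard JI (eqP (valP I)) (eqP (valP J)) leqnn.
move=> w w'; have [<-|ww'] := eqVneq w w'; last first.
  apply/eqP; have [I1|I1] := eqVneq w.1 w'.1; last first.
    have [i iJ iI] := sepP _ _ I1.
    rewrite (signed_perm_row0 _ (i := i)) ?coef0 // => j.
    by rewrite pencilE !mxE (negPf iI) iJ mulr0 addr0.
  have I2 : w.2 != w'.2.
    by apply: contraNneq ww' => I2; case: w w' I1 I2 => [? ?] [? ?] /= -> ->.
  have [j jJ jI] := sepP _ _ I2.
  rewrite (signed_perm_col0 _ (j := j)) ?coef0 // => i.
  rewrite pencilE !mxE.
  have -> : (i \in val w.1) && (j == s w i) = false.
    by apply: contraNF jI => /andP[iI /eqP->]; rewrite sE.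
  have -> : (i \notin val w'.1) && (j == s w' i) = false.
    by apply: contraTF jJ => /andP[iI /eqP->]; rewrite sE.
  by rewrite mulr0 addr0.
apply/negP => /eqP.
rewrite (@signed_perm_monomial _ _ _ _ (s w) (Ordinal n_gt0)) => [|k l _ ls];
  last first.
  by rewrite pencilE !mxE (negPf ls) !andbF mulr0 addr0.
rewrite (bigID (fun i => i \in val w.1)) /= big1 => [|i iI]; last first.
  by rewrite pencilE !mxE iI eqxx mulr0 addr0.
rewrite mul1r (eq_bigr (fun=> 'X)) => [|i iI]; last first.
  by rewrite pencilE !mxE iI (negPf iI) eqxx add0r mulr1.
rewrite prodr_const.
have -> : #|[pred i | i \notin val w.1]| = b.
  have := cardC (mem (val w.1)); rewrite card_ord (eqP (valP w.1)) => an.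
  by apply: (@addnI a); rewrite abn.
rewrite -signr_odd mulr_sign; case: ifP => _;
  rewrite ?coefN coefXn eqxx => /eqP.
  by rewrite oppr_eq0 oner_eq0.
by rewrite oner_eq0.
Qed.

(** * Points of high multiplicity *)

Lemma card_ord_lt (n m : nat) : (m <= n)%N -> #|[set i : 'I_n | (i < m)%N]| = m.
Proof.
move=> mn; have wi : injective (widen_ord mn).
  by move=> i j /(congr1 val) /= ij; apply: val_inj.
rewrite -[RHS]card_ord -(card_imset _ wi).
apply: eq_card => i; rewrite inE; apply/idP/imsetP => [im|[j _ ->]];
  last exact: (valP j).
by exists (Ordinal im) => //; exact: val_inj.
Qed.

(** The zero rows impose [m * n] linear conditions, which together with the [k] columns of [G] are
    fewer than the [n * n] unknowns. *)
Lemma zero_rows_solution (K : fieldType) (n m k : nat) (G : 'M[K]_(n * n, k)) :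
    (m <= n)%N -> (k < n * (n - m))%N ->
  exists z : 'M[K]_n,
  [/\ forall i j, i \in [set i : 'I_n | (i < m)%N] -> z i j = 0,
    z != 0 & mxvec z *m G = 0].
Proof.
move=> mn kn; pose f (u : 'rV[K]_(n * n)) : 'rV_(m * n) :=
  mxvec (rowsub (widen_ord mn) (vec_mx u)).
have flin : linear f.
  move=> c u v; rewrite /f -linearP; congr mxvec.
  by apply/matrixP => i j; rewrite linearP !mxE.
pose F : {linear 'rV_(n * n) -> 'rV_(m * n)} :=
  HB.pack f (GRing.isLinear.Build _ _ _ _ f flin).
have /rowV0Pn[u /sub_kermxP uA u0] : kermx (row_mx G (lin1_mx F)) != 0.
  rewrite -mxrank_eq0 mxrank_ker subn_eq0 -ltnNge (leq_ltn_trans (rank_leq_col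
    _)) //.
  by rewrite addnC -ltn_subRL -mulnBl mulnC.
move: uA; rewrite mul_mx_row -[0 in RHS]row_mx0 => /eq_row_mx[uG];
  rewrite mul_rV_lin1 /= => fu.
exists (vec_mx u); split; last by rewrite vec_mxK.
  2: by apply: contra u0; rewrite -(inj_eq (can_inj mxvecK)) vec_mxK linear0.
move=> i j; rewrite inE => im.
have := congr1 (fun v => vec_mx v (Ordinal im) j) fu.
rewrite /f mxvecK linear0 !mxE /= => <-; congr (u 0 (mxvec_index _ j)).
exact: val_inj.
Qed.

(* Gaussian elimination turns [z] into a diagonal matrix with [n - \rank z]
   null rows. *)
Lemma det_pencil_rank (K : fieldType) (n b : nat) (z y : 'M[K]_n) :
  (\rank z + b < n)%N -> (\det (pencil z y))`_b = 0.
Proof.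
move=> zb; pose L := col_ebase z; pose U := row_ebase z.
have zE : L *m pid_mx (\rank z) *m U = z by exact: mulmx_ebase.
pose y' := invmx L *m y *m invmx U.
have yE : L *m y' *m U = y.
  rewrite /y' !mulmxA mulmxV ?col_ebase_unit // mul1mx mulmxKV //.
  exact: row_ebase_unit.
have -> : pencil z y =
    map_mx polyC L *m pencil (pid_mx (\rank z)) y' *m map_mx polyC U.
  rewrite /pencil mulmxDr mulmxDl -scalemxAr -scalemxAl -!map_mxM zE.
  by rewrite yE.
rewrite !det_mulmx !det_map_mx mulrAC -rmorphM /= mul_polyC.
rewrite -[\det (pencil _ _)]/(signed_perm (@odd_perm _) (pencil _ _)) coefZ.
rewrite (@signed_perm_pencil0 _ _ _ _ _ (~: [set i : 'I_n | (i < \rank z)%N]))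
  ?mulr0 //.
  rewrite cardsCs setCK card_ord card_ord_lt ?rank_leq_row //.
  by rewrite ltn_subRL.
by move=> i j; rewrite !inE mxE => /negPf->; rewrite andbF.
Qed.

(** Modulo 2 the matrix is the identity, so over the integers its determinant is odd. *)
Lemma odd_det_neq0 (R : numDomainType) (n : nat) (A : 'M[nat]_n) :
  \det (\matrix_(i, j) ((A i j).*2 + (i == j))%:R : 'M[R]_n) != 0.
Proof.
pose B : 'M[int]_n := \matrix_(i, j) ((A i j).*2 + (i == j))%:R.
have -> : \matrix_(i, j) ((A i j).*2 + (i == j))%:R = map_mx intr B :> 'M[R]_n.
  by apply/matrixP => i j; rewrite !mxE /= rmorph_nat.
rewrite det_map_mx intr_eq0; apply/eqP => detB.
have := congr1 (intr : int -> 'F_2) detB; rewrite -det_map_mx.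
have -> : map_mx intr B = 1%:M :> 'M['F_2]_n.
  apply/matrixP => i j; rewrite !mxE /= rmorph_nat natrD.
  by rewrite -muln2 natrM (_ : 2%:R = 0) ?mulr0 ?add0r //; apply/eqP.
by rewrite det1 => /eqP; rewrite oner_eq0.
Qed.

Section LowRank.
Variables (K : numClosedFieldType) (t u k : nat).
Local Notation n := (t + u)%N.
Variable G : 'M[K]_(n * n, k).

Definition low_rank : Type := {z : 'M[K]_n | (\rank z <= t)%N}.

(** The linear forms in [G] are appended as extra coordinates, so that imposing them means setting
    coordinates to zero. *)
Definition low_rank_coord (z : low_rank) (i : 'I_(n * n + k)) : K :=
  row_mx (mxvec (val z)) (mxvec (val z) *m G) 0 i.

(** These index the entries outside the lower right block, [n ^ 2 - u ^ 2] in number. *)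
Local Notation entry := ('I_t * 'I_t + ('I_t * 'I_u + 'I_u * 'I_t))%type.

Definition chart_row (w : entry) : 'I_n :=
  match w with
  | inl p => lshift u p.1
  | inr (inl p) => lshift u p.1
  | inr (inr p) => rshift t p.1
  end.

Definition chart_col (w : entry) : 'I_n :=
  match w with
  | inl p => lshift u p.2
  | inr (inl p) => rshift t p.2
  | inr (inr p) => lshift u p.2
  end.

Definition chart (w : entry) : 'I_(n * n + k) :=
  lshift k (mxvec_index (chart_row w) (chart_col w)).

Lemma chartE (z : low_rank) w :
  low_rank_coord z (chart w) = val z (chart_row w) (chart_col w).
Proof. by rewrite /low_rank_coord row_mxEl mxvecE. Qed.

(* A matrix of rank [t] with invertible upper left block [A] has lower right
   block [C A^-1 B], the blocks [A], [B], [C] being free.  Parity makes [A]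
   invertible on a whole grid of values. *)
Lemma low_rank_independent : coord_independent low_rank_coord chart.
Proof.
move=> q c H; pose s (w : entry) (i : 'I_q) : K :=
  ((val i).*2 + (chart_row w == chart_col w))%:R.
apply: (@tensor_vandermonde K _ q s) => [w i j|p].
  move/eqP; rewrite eqr_nat eqn_add2r => /eqP/double_inj; exact: val_inj.
pose A : 'M[K]_t := \matrix_(i, j) s (inl (i, j)) (p (inl (i, j))).
pose B : 'M[K]_(t, u) :=
  \matrix_(i, j) s (inr (inl (i, j))) (p (inr (inl (i, j)))).
pose C : 'M[K]_(u, t) :=
  \matrix_(i, j) s (inr (inr (i, j))) (p (inr (inr (i, j)))).
have Au : A \in unitmx.
  rewrite unitmxE unitfE;
  have := @odd_det_neq0 K t (\matrix_(i, j) val (p (inl (i, j)))).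
  congr (_ != 0); congr (\det _); apply/matrixP => i j; rewrite !mxE /s /=.
  by rewrite (inj_eq (@lshift_inj _ _)).
pose z := col_mx 1%:M (C *m invmx A) *m row_mx A B.
have zt : (\rank z <= t)%N by rewrite (leq_trans (mxrankM_maxl _ _))
  ?rank_leq_col.
have zE : z = block_mx A B C (C *m invmx A *m B).
  by rewrite /z mul_col_row !mul1mx mulmxKV.
rewrite -[RHS](H (exist _ z zt)); apply: eq_bigr => a _; congr (_ * _).
apply: eq_bigr => w _; congr (_ ^+ _); rewrite chartE [val _]/= zE.
case: w => [[i j]|[[i j]|[i j]]] /=.
- by rewrite block_mxEul mxE.
- by rewrite block_mxEur mxE.
by rewrite block_mxEdl mxE.
Qed.

(** The solution is obtained as a point of the closure. Vanishing of the coefficient and the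
    relations defining the extra coordinates are polynomial identities on the cone, so they persist
    there. *)
Lemma low_rank_solution : (k < n ^ 2 - u ^ 2)%N ->
  exists z : 'M[K]_n,
  [/\ forall y b, (t + b < n)%N -> (\det (pencil z y))`_b = 0,
    z != 0 & mxvec z *m G = 0].
Proof.
move=> kn.
have cone (c : K) (x : low_rank) : exists y, forall i,
    low_rank_coord y i = c * low_rank_coord x i.
  have cx : (\rank (c *: val x) <= t)%N.
    exact: leq_trans (mxrankS (scalemx_sub _ (submx_refl _))) (valP x).
  exists (exist _ (c *: val x) cx) => i; rewrite /low_rank_coord /=.
  by rewrite linearZ /= -scalemxAl -scale_row_mx mxE.
have cB : #|[set rshift (n * n) i | i : 'I_k]| = k.
  by rewrite card_imset ?card_ord //; exact: rshift_inj.
have cJ : (#|[set rshift (n * n) i | i : 'I_k]| < #|{: entry}|)%N.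
  rewrite cB !card_sum !card_prod !card_ord (leq_trans kn) //.
  by rewrite leq_subLR eq_leq // -!mulnn; ring.
have [v [[l vl] vB cv]] := projective_dimension cone low_rank_independent cJ.
pose w : 'rV_(n * n + k) := \row_i v i.
have wR : rsubmx w = 0.
  by apply/rowP => i; rewrite !mxE vB ?imset_f.
have wl i : v (lshift k i) = lsubmx w 0 i by rewrite !mxE.
exists (vec_mx (lsubmx w)); split.
- move=> y b tb.
  pose X : 'M[{mpoly K[n * n + k]}]_n :=
    \matrix_(i, j) 'X_(lshift k (mxvec_index i j)).
  pose f := (\det (pencil X (map_mx (@mpolyC _ K) y)))`_b.
  have fE x : f.@[x] =
      (\det (pencil (\matrix_(i, j) x (lshift k (mxvec_index i j))) y))`_b.
    rewrite -[f.@[x]](coef_map (meval x)) -det_map_mx;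
      congr ((\det _ : {poly K})`_b).
    apply/matrixP => i j; rewrite !mxE rmorphD rmorphM /= map_polyX !map_polyC
      /=.
    by rewrite mevalXU mevalC.
  have -> : vec_mx (lsubmx w) = \matrix_(i, j) v (lshift k (mxvec_index i j)).
    by apply/matrixP => i j; rewrite !mxE.
  rewrite -fE; apply: cv => x; rewrite fE det_pencil_rank //.
  suff -> :
      \matrix_(i, j) low_rank_coord x (lshift k (mxvec_index i j)) = val x.
    by apply: leq_ltn_trans tb; rewrite leq_add2r (valP x).
  by apply/matrixP => i j; rewrite mxE /low_rank_coord row_mxEl mxvecE.
- apply: contraTneq vl => /(congr1 mxvec); rewrite vec_mxK linear0 => wL.
  have : w = 0 by rewrite -[w]hsubmxK wL wR row_mx0.
  by move/rowP/(_ l); rewrite !mxE => ->; rewrite eqxx.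
rewrite vec_mxK; apply/rowP => i; rewrite [RHS]mxE.
pose f : {mpoly K[n * n + k]} := 'X_(rshift (n * n) i) -
  \sum_p G p i *: 'X_(lshift k p).
have fE x : f.@[x] = x (rshift (n * n) i) - \sum_p G p i * x (lshift k p).
  rewrite mevalB mevalXU /=; congr (_ - _); rewrite raddf_sum /=.
  by apply: eq_bigr => p _; rewrite mevalZ mevalXU.
have : f.@[v] = 0.
  apply: cv => x; rewrite fE /low_rank_coord row_mxEr mxE; apply/eqP.
  by rewrite subr_eq0; apply/eqP; apply: eq_bigr => p _; rewrite row_mxEl mulrC.
rewrite fE vB ?imset_f // sub0r => /eqP; rewrite oppr_eq0 => /eqP <-.
by rewrite mxE; apply: eq_bigr => p _; rewrite wl mulrC.
Qed.

End LowRank.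

(** * Existence of power sum decompositions *)

(** Expanding the powers gives a sum over maps [f], and inclusion-exclusion over [A] keeps only the
    surjective ones, which are the bijections. *)
Lemma polarization (R : comNzRingType) (n : nat) (y : 'I_n -> R) :
  \sum_(A : {set 'I_n}) (-1) ^+ #|~: A| * (\sum_(j in A) y j) ^+ n =
  (\prod_j y j) *+ #|[pred f : {ffun 'I_n -> 'I_n} | injectiveb f]|.
Proof.
have powE (A : {set 'I_n}) : (\sum_(j in A) y j) ^+ n =
    \sum_(f : {ffun 'I_n -> 'I_n}) \prod_i ((f i \in A)%:R * y (f i)).
  rewrite -(bigA_distr_bigA (fun _ j => (j \in A)%:R * y j)) prodr_const
    card_ord.
  congr (_ ^+ n); rewrite big_mkcond; apply: eq_bigr => j _.
  by case: ifP; rewrite ?mul1r ?mul0r.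
under [LHS]eq_bigr do rewrite powE mulr_sumr.
rewrite exchange_big /= -sumr_const [RHS]big_mkcond; apply: eq_bigr => f _.
under eq_bigr do rewrite big_split /= mulrA.
rewrite -mulr_suml.
have -> : \sum_(A : {set 'I_n}) (-1) ^+ #|~: A| * \prod_i (f i \in A)%:R =
    \prod_j (1 + - (j \notin codom f)%:R) :> R.
  rewrite bigA_distr; apply: eq_big => [A|A _]; first by rewrite inE.
  rewrite [RHS](bigID (fun i => i \in A)) /=.
  under [X in _ = X * _]eq_bigr => i Ai do rewrite Ai.
  rewrite big1_eq mul1r; under [RHS]eq_bigr => i Ai do rewrite (negPf Ai)
    -mulN1r.
  rewrite big_split /= prodr_const; congr (_ * _).
    by congr (_ ^+ _); apply: eq_card => i; rewrite !inE.
  have [/forallP fA|/forallPn[i fA]] := boolP [forall i, f i \in A].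
    rewrite !big1 // => [j jA|i _]; last by rewrite fA.
    by rewrite (contra _ jA) // => /codomP[i ->].
  by rewrite (bigD1 i) //= [RHS](bigD1 (f i)) //= (negPf fA) codom_f !mul0r.
have [finj|ninj] := boolP (injectiveb f).
  rewrite big1 => [|j _]; last by rewrite inj_card_onto ?subr0 //;
    exact/injectiveP.
  by rewrite mul1r inE finj [RHS](reindex_inj (injectiveP _ finj)).
rewrite inE (negPf ninj).
have [j fj] : exists j, j \notin codom f.
  apply/existsP; rewrite -negb_forall; apply: contra ninj => /forallP onto.
  have /image_injP inj : #|image f 'I_n| == #|'I_n|.
    by apply/eqP/eq_card => k; rewrite onto inE.
  by apply/injectiveP => i j; apply: inj.
by rewrite (bigD1 j) //= fj subrr !mul0r.
Qed.

(** This excludes the default value 0 of [waring_rank]. Each monomial is polarized, and [n]-th roots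
    absorb the coefficients into the linear forms. *)
Lemma signed_perm_sum_of_powers (K : numClosedFieldType) (n : nat)
    (e : 'S_n -> bool) :
  (0 < n)%N ->
  exists r, sum_of_powers n (signed_perm e (generic_matrix K n)) r.
Proof.
move=> n_gt0; pose I : finType := ('S_n * {set 'I_n})%type.
pose N := #|[pred f : {ffun 'I_n -> 'I_n} | injectiveb f]|.
have N0 : N%:R != 0 :> K.
  rewrite pnatr_eq0 -lt0n; apply/card_gt0P; exists (finfun id); rewrite inE.
  by apply/injectiveP => i j; rewrite !ffunE.
pose c (w : I) : K := (-1) ^+ e w.1 * (-1) ^+ #|~: w.2| / N%:R.
pose l (w : I) : {mpoly K[n * n]} :=
  n.-root (c w) *: \sum_(i in w.2) 'X_(mxvec_index i (w.1 i)).
exists #|I|, (fun k => l (enum_val k)); split.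
  move=> k; apply/rpredZ/rpred_sum => i _.
  by rewrite dhomogX; apply/eqP/mdeg1.
transitivity (\sum_w l w ^+ n); last first.
  by rewrite (reindex _ (onW_bij _ (@enum_val_bij I))).
transitivity (\sum_(w : I) c w *:
    (\sum_(i in w.2) 'X_(mxvec_index i (w.1 i))) ^+ n : {mpoly K[n * n]}).
  rewrite -(pair_bigA _ (fun s A =>
    c (s, A) *: (\sum_(i in A) 'X_(mxvec_index i (s i))) ^+ n)) /=.
  apply: eq_bigr => s _.
  transitivity (((-1) ^+ e s / N%:R : K) *:
     \sum_(A : {set 'I_n}) (-1) ^+ #|~: A| *
     (\sum_(j in A) 'X_(mxvec_index j (s j))) ^+ n : {mpoly K[n * n]}).
    rewrite polarization -/N -scaler_nat scalerA divfK //.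
    have -> : \prod_i generic_matrix K n i (s i) =
        \prod_j 'X_(mxvec_index j (s j)) by apply: eq_bigr => i _; rewrite mxE.
    by case: (e s); rewrite ?scaleN1r ?scale1r ?mulN1r ?mul1r.
  rewrite scaler_sumr; apply: eq_bigr => A _; rewrite /c /=.
  rewrite mulrAC -[in RHS]scalerA; congr (_ *: _).
  rewrite -signr_odd -[in RHS]signr_odd.
  by case: (odd _); rewrite ?scaleN1r ?scale1r ?mulN1r ?mul1r.
by apply: eq_bigr => w _; rewrite exprZn rootCK.
Qed.

(** * The two rank bounds *)

Lemma signed_perm_waring_lower_bound (K : numClosedFieldType) (n D : nat)
    (e : 'S_n -> bool) (Z : 'M[K]_n -> Prop) :
    (0 < n)%N ->
    (forall z y, Z z -> (signed_perm e (pencil z y))`_(n./2) = 0) ->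
    (forall k (G : 'M[K]_(n * n, k)), (k < D)%N ->
       exists z, [/\ Z z, z != 0 & mxvec z *m G = 0]) ->
  ('C(n, n./2) ^ 2 + D <= waring_rank n (signed_perm e (generic_matrix K n)))%N.
Proof.
move=> n_gt0 ZY ZD.
have [+ _] := waring_rankP (signed_perm_sum_of_powers K e n_gt0).
move=> /sum_of_powers_matrix[C CE].
have half : (n./2 < n)%N by rewrite -divn2 ltn_Pdiv.
have abn : (n - n./2 + n./2 = n)%N by rewrite subnK // ltnW.
have [Q [X [Y [<- XY]]]] := subset_pair_pencil K e abn n_gt0.
apply: (catalecticant_bound CE abn _ XY _ ZD); first by rewrite subn_gt0.
by move=> z j; exact: ZY.
Qed.

Lemma det_polyE (K : comNzRingType) (n : nat) :
  det_poly K n = signed_perm (@odd_perm _) (generic_matrix K n).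
Proof. by []. Qed.

Lemma perm_polyE (K : comNzRingType) (n : nat) :
  perm_poly K n = signed_perm (fun=> false) (generic_matrix K n).
Proof. by apply: eq_bigr => s _; rewrite mul1r. Qed.

Theorem corollary1p4 (R : realType) (n : nat) (hn : (1 <= n)%N) :
  ('C(n, n./2) ^ 2 + (n ^ 2 - (n./2 + 1) ^ 2)
     <= waring_rank n (det_poly R[i] n))%N /\
  ('C(n, n./2) ^ 2 + n * (n - n./2 - 1)
     <= waring_rank n (perm_poly R[i] n))%N.
Proof.
have half : (n./2 < n)%N by rewrite -divn2 ltn_Pdiv.
split; last first.
  rewrite perm_polyE -subnDA addn1.
  (* One zero row more than [n./2] kills the coefficient of degree [n./2]. *)
  apply: (signed_perm_waring_lower_bound (Z := fun z => forall i j,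
    i \in [set i : 'I_n | (i < n./2.+1)%N] -> z i j = 0)) => //.
    by move=> z y z0; apply: signed_perm_pencil0 z0; rewrite card_ord_lt.
  by move=> k G; exact: zero_rows_solution.
rewrite det_polyE.
(* [Z] asks for vanishing coefficients rather than small rank, because solutions are produced as
   points of a closure. *)
apply: (signed_perm_waring_lower_bound (Z := fun z => forall y,
  (\det (pencil z y))`_(n./2) = 0)) => // [z y|k G kD]; first exact.
(* With [u = n./2 + 1] the rank bound [t = n - u] gives [t + n./2 = n - 1], just below [n]. *)
have [t [u [tn un]]] : exists t u, (n = t + u)%N /\ (u = n./2 + 1)%N.
  by exists (n - n./2.+1)%N, (n./2 + 1)%N; rewrite addn1 subnK.
have tb : (t + n./2 < n)%N by rewrite [X in (_ < X)%N]tn ltn_add2l un addn1.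
move: (n./2) tb un kD => b; rewrite {half hn}.
case: _ / (esym tn) G => G tb un; rewrite -un => /(low_rank_solution G)
  [z [zP z0 zG]].
by exists z; split=> // y; apply: zP.
Qed.
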